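(* Let $s\ge 2$ and $n\ge 1$ be integers and let $P,Q\subset[s]$ be non-empty and disjoint. Let $\mathcal{F},\mathcal{G}\subset[s]^n$ be such that $\mathcal{F}$ is $P$-complete and $\mathcal{G}$ is $Q$-complete. Then $$|\mathcal{F}|\,|\mathcal{G}|\ge s^n\,|\mathcal{F}\cap\mathcal{G}|.$$
   Context: $[s]=\{1,\ldots,s\}$ and $[s]^n$ is the set of all sequences $(x_1,\ldots,x_n)$ with $x_i\in[s]$. For $P\subset[s]$, write $(x_1,\ldots,x_n)<_P(y_1,\ldots,y_n)$ if for every $1\le i\le n$ either $x_i=y_i$ or $x_i\notin P$. A family $\mathcal{F}\subset[s]^n$ is $P$-complete if whenever $\vec x\in\mathcal{F}$ and $\vec x<_P\vec y$, also $\vec y\in\mathcal{F}$. *)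

(* Defs.v *)
From mathcomp Require Import all_boot.

Set Implicit Arguments.
Unset Strict Implicit.
Unset Printing Implicit Defensive.

(* The alphabet {1, ..., s} is encoded as 'I_s = {0, ..., s - 1}; only the
   identity of letters matters, never their numerical value. *)

(* The relation x <_P y; despite the notation it is reflexive. *)
Definition below (s n : nat) (P : {set 'I_s}) (x y : n.-tuple 'I_s) : Prop :=
  forall i : 'I_n, tnth x i = tnth y i \/ tnth x i \notin P.

Definition complete (s n : nat) (P : {set 'I_s})
    (F : {set n.-tuple 'I_s}) : Prop :=
  forall x y : n.-tuple 'I_s, x \in F -> below P x y -> y \in F.

(* Main.v *)
Require Import Defs.
From mathcomp Require Import all_boot.

(** Induction on [n].  Slicing [F] and [G] along the first letter, the induction
    hypothesis for each pair of slices [(F_a, G_b)] reduces the inequality to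
    [s * \sum_a #|F_a :&: G_a| <= \sum_a \sum_b #|F_a :&: G_b|].  Counting both
    sides point by point over the tails [y], this follows from the case of
    one-letter words: a complete set of letters is either everything or
    contained in [P] (resp. [Q]), and [P] and [Q] are disjoint. *)

Lemma letter_complete_cases (T : finType) (P A : {set T}) :
    (forall a b, a \in A -> a \notin P -> b \in A) ->
  A = setT \/ A \subset P.
Proof.
move=> hA; have [|/subsetPn [a aA aP]] := boolP (A \subset P); first by right.
by left; apply/setP=> b; rewrite inE (hA a b).
Qed.

(** If [A] or [B] is the whole alphabet, equality holds; otherwise [A] lies in [P] and [B] in [Q],
    so [A :&: B] is empty. *)
Lemma letter_correlation (T : finType) (P Q A B : {set T}) :
    [disjoint P & Q] ->
    (forall a b, a \in A -> a \notin P -> b \in A) ->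
    (forall a b, a \in B -> a \notin Q -> b \in B) ->
  #|T| * #|A :&: B| <= #|A| * #|B|.
Proof.
move=> dPQ /letter_complete_cases [-> _|sAP].
  by rewrite setTI cardsT.
move=> /letter_complete_cases [->|sBQ].
  by rewrite setIT cardsT mulnC.
have /disjoint_setI0 -> : [disjoint A & B].
  exact: disjointWl sAP (disjointWr sBQ dPQ).
by rewrite cards0 muln0.
Qed.

Definition slice (T : finType) (n : nat) (F : {set n.+1.-tuple T}) (a : T) :
  {set n.-tuple T} := [set y | cons_tuple a y \in F].

Arguments slice {T n} F a.


Lemma card_slices (T : finType) (n : nat) (F : {set n.+1.-tuple T}) :
  #|F| = \sum_a #|slice F a|.
Proof.
rewrite -sum1_card (reindex (fun p : T * n.-tuple T => cons_tuple p.1 p.2)) /=.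
  rewrite (eq_bigl (fun p => p.2 \in slice F p.1)); last by case=> a y; rewrite inE.
  by rewrite -(pair_big_dep xpredT (fun a y => y \in slice F a) (fun _ _ => 1));
    apply: eq_bigr => a _; rewrite sum1_card.
exists (fun x => (thead x, behead_tuple x)) => [[a y] _ | x _] /=.
  by congr (_, _); apply: val_inj.
by rewrite [RHS]tuple_eta; apply: val_inj.
Qed.

Lemma complete_slice (s n : nat) (P : {set 'I_s}) (F : {set n.+1.-tuple 'I_s}) (a : 'I_s) :
  complete P F -> complete P (slice F a).
Proof.
move=> hF x y; rewrite !inE => xF xy; apply: hF xF _ => i.
have [j ->|->] := unliftP ord0 i; last by left.
by rewrite !tnthS; apply: xy.
Qed.

(** For a fixed tail [y], this makes the set of its possible heads a one-letter complete set, as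
    [letter_correlation] requires. *)
Lemma complete_head (s n : nat) (P : {set 'I_s}) (F : {set n.+1.-tuple 'I_s})
    (y : n.-tuple 'I_s) (a b : 'I_s) :
  complete P F -> y \in slice F a -> a \notin P -> y \in slice F b.
Proof.
rewrite !inE => hF yF aP; apply: hF yF _ => i.
have [j ->|->] := unliftP ord0 i; last by right; rewrite tnth0.
by left; rewrite !tnthS.
Qed.

(** Double counting of the pairs [(i, y)] with [y \in F i]. *)
Lemma card_indexed_family (I T : finType) (F : I -> {set T}) :
  \sum_i #|F i| = \sum_y #|[set i | y \in F i]|.
Proof.
under eq_bigr do rewrite -sum1_card big_mkcond.
rewrite exchange_big; apply: eq_bigr => y _.
by rewrite -sum1_card [RHS]big_mkcond; apply: eq_bigr => i _; rewrite inE.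
Qed.

Lemma complete_correlation (s n : nat) (P Q : {set 'I_s}) (F G : {set n.-tuple 'I_s}) :
    [disjoint P & Q] -> complete P F -> complete Q G ->
  s ^ n * #|F :&: G| <= #|F| * #|G|.
Proof.
move=> dPQ; elim: n F G => [|n IHn] F G hF hG.
  (* For [n = 0] the factor [s ^ n] is 1, and a common word gives [#|G| >= 1]. *)
  rewrite mul1n; have [->|/set0Pn [x]] := eqVneq (F :&: G) set0.
    by rewrite cards0.
  rewrite inE => /andP[_ xG]; apply: (@leq_trans #|F|).
    exact/subset_leq_card/subsetIl.
  by apply: leq_pmulr; apply/card_gt0P; exists x.
pose F_ := slice F; pose G_ := slice G.
have slices : s * #|F :&: G| <= \sum_a \sum_b #|F_ a :&: G_ b|.
  rewrite card_slices card_indexed_family pair_big /=.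
  rewrite (card_indexed_family _ _ (fun p => F_ p.1 :&: G_ p.2)).
  rewrite big_distrr; apply: leq_sum => y _ /=.
  have -> : [set a | y \in slice (F :&: G) a] =
            [set a | y \in F_ a] :&: [set b | y \in G_ b].
    by apply/setP=> a; rewrite !inE.
  (* On the right, [y] is counted once for each pair of a head from [F] and a head chosen
     independently from [G], hence a product set. *)
  have -> : [set p | y \in F_ p.1 :&: G_ p.2] =
            setX [set a | y \in F_ a] [set b | y \in G_ b].
    by apply/setP=> p; rewrite !inE.
  rewrite cardsX -[X in X * _]card_ord.
  by apply: letter_correlation dPQ _ _ => a b;
    rewrite [_ \in _]in_set [b \in _]in_set; apply: complete_head.
(* One factor [s] is spent on [slices]; the remaining [s ^ n] goes to the induction hypothesis for
   each pair [(a, b)]. *)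
rewrite expnSr -mulnA (leq_trans (leq_mul (leqnn _) slices)) //.
rewrite (card_slices _ _ F) (card_slices _ _ G) big_distrlr big_distrr /=.
apply: leq_sum => a _; rewrite big_distrr; apply: leq_sum => b _ /=.
by apply: IHn; apply: complete_slice.
Qed.

Theorem theorem5 (s n : nat) (hs : 2 <= s) (hn : 1 <= n)
    (P Q : {set 'I_s}) (hP : P != set0) (hQ : Q != set0)
    (hPQ : [disjoint P & Q])
    (F G : {set n.-tuple 'I_s})
    (hF : complete P F) (hG : complete Q G) :
  #|F| * #|G| >= s ^ n * #|F :&: G|.
Proof. exact: complete_correlation hPQ hF hG. Qed.
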